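(* Let $k>1$ and $n>0$ be integers and let $\Gamma=Q_n^k$ be the $k$-ary $n$-cube. Let $\Omega=\{\pm e_i : 1\leq i\leq n\}\subseteq\mathbb{Z}_k^n$, where $e_i=(0,\ldots,0,1,0,\ldots,0)$ with $1$ at the $i$-th position. If $k=2$, then $Aut(\Gamma)\cong \mathbb{Z}_2^n\rtimes Sym([n])$, and hence $|Aut(\Gamma)|=2^n\, n!$. If $k>2$ and $k\neq 4$, then $Aut(\Gamma)\cong \mathbb{Z}_k^n\rtimes A$ and $|Aut(\Gamma)|=k^n\,2^n\,n!$, where $A$ is the group of all automorphisms $f$ of the group $\mathbb{Z}_k^n$ such that $f(\Omega)=\Omega$. Moreover, $\Gamma$ is a symmetric graph.
   Context: For integers $k>1$ and $n>0$, the $k$-ary $n$-cube $Q_n^k$ is the simple undirected graph with vertex set $\mathbb{Z}_k^n$ in which two vertices $(x_1,\ldots,x_n)$ and $(y_1,\ldots,y_n)$ are adjacent if and only if there is an integer $j$, $1\leq j\leq n$, such that $x_j=y_j\pm 1 \pmod k$ and $x_i=y_i$ for all $i\neq j$. $\mathbb{Z}_k$ is the additive cyclic group of order $k$, $[n]=\{1,\ldots,n\}$, and $Sym([n])$ is the symmetric group on $[n]$. $Aut(\Gamma)$ denotes the group of graph automorphisms of $\Gamma$. In the semidirect products, $Sym([n])$ acts on $\mathbb{Z}_2^n$ by permuting the coordinates (i.e. permuting the $e_i$), and $A$ acts on $\mathbb{Z}_k^n$ naturally as a group of automorphisms. A graph $\Gamma$ is symmetric (arc-transitive) if for all vertices $u,v,x,y$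 such that $u$ and $v$ are adjacent and $x$ and $y$ are adjacent, there is $\pi\in Aut(\Gamma)$ with $\pi(u)=x$ and $\pi(v)=y$. *)

(* Defs.v *)
From mathcomp Require Import all_boot all_order all_fingroup all_algebra.
Set Implicit Arguments.
Unset Strict Implicit.
Unset Printing Implicit Defensive.
Import GRing.Theory.
Local Open Scope ring_scope.

Record sgraph := SGraph {
  vertex :> finType;
  adj : rel vertex;
  adj_sym : symmetric adj;
  adj_irr : irreflexive adj }.

Definition graph_aut (G : sgraph) : {set {perm G}} :=
  [set s : {perm G} | [forall x : G, forall y : G, adj (s x) (s y) == adj x y]].

Lemma graph_autP (G : sgraph) (s : {perm G}) :
  reflect (forall x y : G, adj (s x) (s y) = adj x y) (s \in graph_aut G).
Proof.
rewrite inE; apply: (iffP forallP) => [h x y | h x].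
  by have /forallP/(_ y)/eqP := h x.
by apply/forallP => y; rewrite h.
Qed.

Lemma graph_aut_group_set (G : sgraph) : group_set (graph_aut G).
Proof.
apply/group_setP; split=> [|s t /graph_autP hs /graph_autP ht].
  by apply/graph_autP => x y; rewrite !perm1.
by apply/graph_autP => x y; rewrite !permM ht hs.
Qed.

Canonical graph_aut_group (G : sgraph) := Group (graph_aut_group_set G).

Definition symmetric_graph (G : sgraph) : Prop :=
  forall u v x y : G, adj u v -> adj x y ->
  exists s : {perm G}, [/\ s \in graph_aut G, s u = x & s v = y].

(* For k > 1 the type 'Z_k is the ring of integers mod k; for k = 0 and k = 1
   it is the integers mod 2, so the definitions below are only meaningful
   for k > 1. *)
Definition kcube_adj (k n : nat) : rel 'rV['Z_k]_n := fun x y =>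
  [exists j, ((x 0 j == y 0 j + 1) || (x 0 j == y 0 j - 1)) &&
             [forall i, (i != j) ==> (x 0 i == y 0 i)]].

Lemma kcube_adj_sym (k n : nat) : symmetric (@kcube_adj k n).
Proof.
suff h x y : @kcube_adj k n x y -> kcube_adj y x.
  by move=> x y; apply/idP/idP; apply: h.
case/existsP => j /andP[hj /forallP hi]; apply/existsP; exists j.
apply/andP; split; last by apply/forallP => i; rewrite [y 0 i == _]eq_sym.
by case/orP: hj => /eqP ->; rewrite ?addrK ?subrK eqxx ?orbT.
Qed.

Lemma kcube_adj_irr (k n : nat) : irreflexive (@kcube_adj k n).
Proof.
move=> x; apply/negbTE/existsPn => j; rewrite negb_and negb_or.
rewrite -subr_eq0 opprD addNKr oppr_eq0 oner_eq0 /=.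
by rewrite -subr_eq0 opprB addrC subrK oner_eq0.
Qed.

Definition kcube (k n : nat) : sgraph :=
  SGraph (@kcube_adj_sym k n) (@kcube_adj_irr k n).

(* (v . s) 0 (s i) = v 0 i, i.e. e_i . s = e_(s i): the inverse makes this
   an action for the convention (s * t) i = t (s i). *)
Definition coord_perm (k n : nat) (v : 'rV['Z_k]_n) (s : 'S_n) : 'rV['Z_k]_n :=
  col_perm s^-1%g v.

Lemma coord_perm_is_action (k n : nat) : is_action [set: 'S_n] (@coord_perm k n).
Proof.
split=> [s u v /rowP huv | v s t _ _].
  by apply/rowP => i; have := huv (s i); rewrite !mxE permK.
by apply/rowP => i; rewrite !mxE invMg permM.
Qed.

Canonical coord_perm_action (k n : nat) := Action (@coord_perm_is_action k n).

Lemma coord_perm_is_groupAction (k n : nat) :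
  is_groupAction [set: 'rV['Z_k]_n] (coord_perm_action k n).
Proof.
move=> s _; rewrite inE; apply/andP; split; first by apply/subsetP => x; rewrite inE.
apply/morphicP => u v _ _; rewrite !actpermE /=.
by apply/rowP => i; rewrite !mxE.
Qed.

Canonical coord_perm_groupAction (k n : nat) :=
  GroupAction (@coord_perm_is_groupAction k n).

Definition kcube_Omega (k n : nat) : {set 'rV['Z_k]_n} :=
  [set delta_mx 0 i | i : 'I_n] :|: [set - delta_mx 0 i | i : 'I_n].

Definition kcube_A (k n : nat) : {set {perm 'rV['Z_k]_n}} :=
  [set f in Aut [set: 'rV['Z_k]_n] | f @: kcube_Omega k n == kcube_Omega k n].

Lemma kcube_A_group_set (k n : nat) : group_set (kcube_A k n).
Proof.
apply/group_setP; split=> [|f g].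
  rewrite inE group1 /=; apply/eqP.
  by rewrite -[RHS]imset_id; apply: eq_imset => x; rewrite perm1.
rewrite ![_ \in kcube_A _ _]in_set => /andP[fA /eqP fO] /andP[gA /eqP gO].
rewrite groupM //=.
rewrite -{2}gO -{2}fO -imset_comp; apply/eqP.
by apply: eq_imset => x; rewrite permM.
Qed.

Canonical kcube_A_group (k n : nat) := Group (kcube_A_group_set k n).

Lemma kcube_A_sub (k n : nat) : kcube_A k n \subset Aut [set: 'rV['Z_k]_n].
Proof. by apply/subsetP => f; rewrite inE => /andP[]. Qed.

Definition kcube_A_groupAction (k n : nat) :
    groupAction (kcube_A k n) [set: 'rV['Z_k]_n] :=
  ([Aut [set: 'rV['Z_k]_n]] \ kcube_A_sub k n)%gact.

(* Main.v *)
(* Two vertices are adjacent when they differ by an element of Omega. If k <> 4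
   and a <> b in Omega, the common neighbours of x + a and x + b are exactly x
   and x + a + b (which coincide when b = - a). Hence an automorphism f sends
   these parallelograms to parallelograms and the straight paths x - a, x, x + a
   to straight paths, so that f (x + a) - f x does not depend on x. If moreover
   f 0 = 0, then f is additive, so the stabiliser of 0 is A, the group of signed
   coordinate permutations, and the translations provide a regular normal
   complement. For k = 2 the signs are trivial. *)
Require Import Defs.
From mathcomp Require Import all_boot all_order all_fingroup all_algebra.
From mathcomp Require Import ring.
Set Implicit Arguments.
Unset Strict Implicit.
Unset Printing Implicit Defensive.
Import GRing.Theory.
Local Open Scope ring_scope.

Lemma Zp_natr_eq0 (k m : nat) : (1 < k)%N -> (m%:R == 0 :> 'Z_k) = (k %| m)%N.
Proof. by move=> hk; rewrite -val_eqE /= val_Zp_nat. Qed.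

(** * Signed unit vectors, and adjacency as a difference in [Omega] *)

Section Omega.

Variables (k n : nat).
Local Notation V := 'rV['Z_k]_n.
Local Notation e i := (delta_mx 0 i : V).
Local Notation Omega := (kcube_Omega k n).

Lemma OmegaP (a : V) :
  reflect (exists i (s : bool), a = (-1) ^+ s *: e i) (a \in Omega).
Proof.
rewrite inE; apply: (iffP orP).
  case=> /imsetP[i _ ->]; exists i; first by exists false; rewrite expr0 scale1r.
  by exists true; rewrite expr1 scaleN1r.
case=> i [[] ->]; [right | left]; apply/imsetP; exists i => //.
  by rewrite expr1 scaleN1r.
by rewrite expr0 scale1r.
Qed.

Lemma delta_Omega i : e i \in Omega.
Proof. by apply/OmegaP; exists i, false; rewrite expr0 scale1r. Qed.

Lemma OmegaN (a : V) : (- a \in Omega) = (a \in Omega).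
Proof.
have h b : b \in Omega -> - b \in Omega.
  case/OmegaP=> i [s ->]; apply/OmegaP; exists i, (~~ s).
  by rewrite -scaleNr signrN.
by apply/idP/idP => /h //; rewrite opprK.
Qed.

Lemma kcube_adjE (x y : V) : kcube_adj x y = (y - x \in Omega).
Proof.
apply/existsP/OmegaP.
  case=> j /andP[hj /forallP hi]; exists j; case/orP: hj => /eqP hj.
    exists true; apply/rowP => i; rewrite !mxE /=.
    have := hi i; case: eqVneq => [-> _|_] /=; first by rewrite hj; ring.
    by move/eqP=> ->; ring.
  exists false; apply/rowP => i; rewrite !mxE /=.
  have := hi i; case: eqVneq => [-> _|_] /=; first by rewrite hj; ring.
  by move/eqP=> ->; ring.
case=> j [s /(canRL (subrK _)) ->]; exists j; apply/andP; split.
  rewrite !mxE !eqxx /=; apply/orP.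
  by case: s; [left | right]; apply/eqP; ring.
by apply/forallP => i; apply/implyP => /negbTE h; rewrite !mxE h andbF mulr0 add0r.
Qed.

(** Each coordinate is a natural multiple of 1 in ['Z_k], so every vector is reached from 0 by
    adding basis vectors, without subtraction. *)
Lemma rV_delta_ind (P : V -> Prop) :
  P 0 -> (forall v i, P v -> P (v + e i)) -> forall v, P v.
Proof.
(* Unlike [P], the property [Q] is closed under sums, as [big_ind] requires. *)
move=> P0 PD v; pose Q w := forall u, P u -> P (u + w).
suff: Q v by move/(_ 0 P0); rewrite add0r.
rewrite [v]row_sum_delta; apply: (big_ind Q) => [u Pu|w z Qw Qz u Pu|i _ u Pu].
- by rewrite addr0.
- by rewrite addrA; apply/Qz/Qw.
rewrite -[v 0 i]natr_Zp; elim: (nat_of_ord _) => [|m IHm].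
  by rewrite scale0r addr0.
by rewrite mulrSr scalerDl scale1r addrA; apply: PD.
Qed.

Lemma additive_ext (f g : V -> V) :
    {morph f : x y / x + y} -> {morph g : x y / x + y} ->
  (forall i, f (e i) = g (e i)) -> f =1 g.
Proof.
have h0 (h : V -> V) : {morph h : x y / x + y} -> h 0 = 0 :> V.
  by move=> hD; apply: (@addrI _ (h 0)); rewrite -hD !addr0.
move=> fD gD fg; elim/rV_delta_ind => [|v i IH]; first by rewrite !h0.
by rewrite fD gD IH fg.
Qed.

(** * Coincidences between sums of two signed unit vectors *)

Hypothesis hk : (1 < k)%N.

Lemma Zk2_neq0 : k <> 2 -> 2%:R != 0 :> 'Z_k.
Proof.
move=> k2; rewrite Zp_natr_eq0 //; apply/negP => /dvdn_leq => /(_ isT).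
by case: k hk k2 => [|[|[|]]].
Qed.

Lemma Zk_sign_inj (s t : bool) : k <> 2 -> (-1) ^+ s = (-1) ^+ t :> 'Z_k -> s = t.
Proof.
move=> /Zk2_neq0/eqP k2; case: s t => [] [] //= h; case: k2.
  by rewrite -[2%:R]/(1 + 1) -{1}[1]h addNr.
by rewrite -[2%:R]/(1 + 1) {1}[1]h addNr.
Qed.

(** Coordinate [i] of the left side is a unit, which determines the index; the sign is determined
    only when 1 and -1 differ. *)
Lemma signed_delta_inj i j (s t : bool) :
  (-1) ^+ s *: e i = (-1) ^+ t *: e j -> i = j /\ (k <> 2 -> s = t).
Proof.
move=> E; have ij : i = j.
  apply/eqP/contraT => ij; have /rowP/(_ i)/eqP := E.
  by rewrite !mxE !eqxx (negbTE ij) andbF mulr0 mulr1 signr_eq0.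
split=> // k2; have /rowP/(_ i) := E; rewrite ij !mxE !eqxx !mulr1.
exact: Zk_sign_inj.
Qed.

Hypothesis k4 : k <> 4.

Lemma Zk4_neq0 : k <> 2 -> 4%:R != 0 :> 'Z_k.
Proof.
move=> k2; rewrite Zp_natr_eq0 //; apply/negP => kdvd.
have := @dvdn_leq k 4 isT kdvd.
by case: k hk k2 k4 kdvd => [|[|[|[|[|]]]]].
Qed.

(* This fails for k = 4, where e_i + e_i = - e_i - e_i. *)
Lemma Omega_addr_eq (a b c d : V) :
    a \in Omega -> b \in Omega -> c \in Omega -> d \in Omega ->
  a + c = b + d -> [\/ a = b, c = b | c = - a].
Proof.
case/OmegaP=> i [s ->] /OmegaP[j [t ->]] /OmegaP[m [u ->]] /OmegaP[p [v ->]].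
have sg0 (w : bool) : (-1) ^+ w != 0 :> 'Z_k by rewrite signr_eq0.
move/rowP => E.
have {}E l : (-1) ^+ s * (l == i)%:R + (-1) ^+ u * (l == m)%:R
           = (-1) ^+ t * (l == j)%:R + (-1) ^+ v * (l == p)%:R :> 'Z_k.
  by have := E l; rewrite !mxE !eqxx.
(* If [a] and [c] lie on different axes, their sum has exactly two nonzero coordinates, one from
   each of [b] and [d]; so [b] is [a] or [c]. *)
have [im|im] := eqVneq i m; last first.
  have Ei := E i; have Em := E m; move: Ei Em.
  rewrite !eqxx [m == i]eq_sym (negbTE im) !(mulr0, mulr1, addr0, add0r).
  have [ij|ij] := eqVneq i j.
    rewrite -ij [m == i]eq_sym (negbTE im) mulr0 add0r.
    have [mp|mp] := eqVneq m p; last by rewrite mulr0 => _ /eqP; rewrite (negbTE (sg0 _)).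
    by rewrite -mp (negbTE im) mulr0 mulr1 addr0 => -> _; constructor 1.
  have [ip|ip] := eqVneq i p; last by rewrite !mulr0 addr0 => /eqP; rewrite (negbTE (sg0 _)).
  rewrite -ip [m == i]eq_sym (negbTE im) !mulr0 addr0 => _.
  have [->|mj] := eqVneq m j; last by rewrite mulr0 => /eqP; rewrite (negbTE (sg0 _)).
  by rewrite mulr1 => ->; constructor 2.
rewrite -{m}im in E *.
have [us|us] := eqVneq u (~~ s).
  by constructor 3; rewrite us signrN scaleNr.
have {us}us : u = s by case: u s us {E} => [] [].
rewrite {u}us in E *.
have [k2|/eqP k2] := eqVneq k 2.
  have Z2 : 2%:R = 0 :> 'Z_k by apply/eqP; rewrite Zp_natr_eq0 // k2.
  constructor 3; rewrite -scaleNr; congr (_ *: _).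
  by rewrite -[LHS]subr0 -[X in _ - X](mulr0 ((-1) ^+ s)) -Z2; ring.
have Z2 := Zk2_neq0 k2.
have Z4 := Zk4_neq0 k2.
have Ei := E i; rewrite !eqxx !mulr1 in Ei.
(* Now [a = c], and coordinate [i] of the sum is 2 or -2, which is nonzero; this forces [b] and [d]
   onto the same axis. *)
have s2 : (-1) ^+ s + (-1) ^+ s != 0 :> 'Z_k.
  by case: s {E Ei}; rewrite ?expr1 ?expr0 -?opprD ?oppr_eq0.
have [ij|ij] := eqVneq i j; last first.
  have Ej := E j; rewrite eq_sym (negbTE ij) !mulr0 add0r eqxx mulr1 in Ej.
  have [jp|jp] := eqVneq j p; last first.
    by move/eqP: Ej; rewrite (negbTE jp) mulr0 !addr0 eq_sym (negbTE (sg0 _)).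
  by case/eqP: s2; rewrite Ei -jp (negbTE ij) !mulr0 addr0.
rewrite -{j}ij eqxx mulr1 in E Ei *.
have [ip|ip] := eqVneq i p; last first.
  have := E p; rewrite eqxx [p == i]eq_sym (negbTE ip) !mulr0 !add0r mulr1.
  by move/esym/eqP; rewrite (negbTE (sg0 _)).
constructor 1; congr (_ *: _); move: Ei; rewrite -ip eqxx mulr1.
have [->//|ts] := eqVneq t s.
have {ts}-> : t = ~~ s by case: t s ts {E s2} => [] [].
rewrite signrN; have [->|vs] := eqVneq v s.
  by rewrite addNr => /eqP; rewrite (negbTE s2).
(* What remains is [b = d = - a], where [a + a = - a - a] would give 4 = 0. *)
have {vs}-> : v = ~~ s by case: v s vs {E s2} => [] [].
rewrite signrN => h; case/eqP: Z4.
have : (-1) ^+ s + (-1) ^+ s - (- (-1) ^+ s - (-1) ^+ s) = 0 :> 'Z_k.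
  by rewrite h subrr.
case: s {E s2 h}; rewrite ?expr1 ?expr0 => h; last by rewrite -h; ring.
by apply: oppr_inj; rewrite oppr0 -[RHS]h; ring.
Qed.

(** * Rigidity of graph automorphisms *)

Lemma graph_aut_Omega (f : {perm V}) (x y : V) :
  f \in graph_aut (kcube k n) -> (f y - f x \in Omega) = (y - x \in Omega).
Proof. by move=> /graph_autP fA; rewrite -!kcube_adjE; apply: fA. Qed.

Lemma graph_aut_parallelogram (f : {perm V}) (x a b : V) :
    f \in graph_aut (kcube k n) -> a \in Omega -> b \in Omega ->
  a != b -> b != - a -> f (x + a + b) + f x = f (x + a) + f (x + b).
Proof.
move=> fA Oa Ob ab ba.
(* The two paths from [f x] to [f (x + a + b)] have equal sums of steps. Injectivity of [f] excludes
   the first alternative by [a != b] and the third by [b != - a]; the second is the claim. *)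
have [] := @Omega_addr_eq (f (x + a) - f x) (f (x + b) - f x)
  (f (x + a + b) - f (x + a)) (f (x + a + b) - f (x + b)).
- by rewrite graph_aut_Omega // addrAC subrr add0r.
- by rewrite graph_aut_Omega // addrAC subrr add0r.
- by rewrite graph_aut_Omega // addrAC subrr add0r.
- rewrite graph_aut_Omega //; have -> // : x + a + b - (x + b) = a.
  by apply/rowP => l; rewrite !mxE; ring.
- by rewrite ![_ - f x + _]addrC !addrA !subrK.
- by move/addIr/perm_inj/addrI/eqP; rewrite (negbTE ab).
- move=> h; have := congr1 (fun z => z + f (x + a) + f x) h.
  by rewrite subrK => ->; rewrite addrAC subrK addrC.
rewrite opprB => /addIr/perm_inj/eqP.
by rewrite -addrA -subr_eq0 addrAC subrr add0r addrC addr_eq0 (negbTE ba).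
Qed.

Lemma graph_aut_straight (f : {perm V}) (x a : V) :
    f \in graph_aut (kcube k n) -> a \in Omega ->
  f (x + a) + f (x - a) = f x + f x.
Proof.
(* For [k = 2] both sides vanish: [- a = a] and every vector is its own opposite. *)
move=> fA Oa; have [k2|/eqP k2] := eqVneq k 2.
  have VV (v : V) : v + v = 0.
    rewrite -mulr2n -scaler_nat; apply/eqP.
    have /eqP -> : 2%:R == 0 :> 'Z_k by rewrite Zp_natr_eq0 // k2.
    by rewrite scale0r.
  have -> : - a = a by apply/eqP; rewrite eq_sym -addr_eq0 VV.
  by rewrite !VV.
have aNa : a != - a.
  case/OmegaP: Oa => i [s ->]; apply/eqP; rewrite -scaleNr -signrN.
  by case/signed_delta_inj => _ /(_ k2); case: s.
apply/eqP/contraT => h.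
(* If the claim fails, [z] is a common neighbour of [f (x + a)] and [f (x - a)] other than [f x].
   Its preimage [y] is a common neighbour of [x + a] and [x - a], hence equal to [x]: a
   contradiction. *)
pose z := f (x + a) + f (x - a) - f x.
have Oa' : f (x + a) - f x \in Omega by rewrite graph_aut_Omega // addrAC subrr add0r.
have Ob' : f (x - a) - f x \in Omega.
  by rewrite graph_aut_Omega // addrAC subrr add0r OmegaN.
pose y := (f^-1)%g z; have fy : f y = z by rewrite permKV.
have [] := @Omega_addr_eq a (- a) (y - (x + a)) (y - (x - a)).
- by [].
- by rewrite OmegaN.
- by rewrite -(graph_aut_Omega _ _ fA) fy /z addrAC [f (x + a) + _]addrC addrK.
- by rewrite -(graph_aut_Omega _ _ fA) fy /z addrAC addrK.
- by apply/rowP => l; rewrite !mxE; ring.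
- by move/eqP; rewrite (negbTE aNa).
all: move=> yE; have {}yE : y = x by rewrite -[y](subrK (x + a)) yE addrC addrK.
all: by case/eqP: h; rewrite -[LHS](subrK (f x)) -/z -fy yE.
Qed.

Lemma graph_aut_step (f : {perm V}) (x a : V) :
    f \in graph_aut (kcube k n) -> a \in Omega ->
  f (x + a) - f x = f a - f 0.
Proof.
(* The increment along [a] is compared at [x] and [x + b]: by a straight path when [b] is [a] or
   [- a], by a parallelogram otherwise. *)
move=> fA Oa; elim/rV_delta_ind: x => [|x i <-]; first by rewrite add0r.
have Ob := delta_Omega i; set b := e i in Ob *.
have [ab|ab] := eqVneq a b.
  have := graph_aut_straight (x + b) fA Ob; rewrite ab addrK => h.
  by apply: (canLR (addrK _)); rewrite [RHS]addrAC -h addrK.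
have [ba|ba] := eqVneq b (- a).
  have h := graph_aut_straight x fA Oa.
  by apply: (canLR (addrK _)); rewrite ba subrK [RHS]addrAC h addrK.
have := graph_aut_parallelogram x fA Oa Ob ab ba.
rewrite [x + a + b]addrAC => h.
by apply: (canLR (addrK _)); rewrite [RHS]addrAC -h addrK.
Qed.

Lemma graph_aut_additive (f : {perm V}) :
  f \in graph_aut (kcube k n) -> f 0 = 0 -> {morph f : x y / x + y}.
Proof.
move=> fA f0 x; elim/rV_delta_ind => [|y i IH]; first by rewrite f0 !addr0.
have step z : f (z + e i) = f z + f (e i).
  have := graph_aut_step z fA (delta_Omega i); rewrite f0 subr0 => <-.
  by rewrite [RHS]addrC subrK.
by rewrite addrA !step IH addrA.
Qed.

End Omega.

(** * The stabiliser of 0 as a group of signed coordinate permutations *)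

Section Stabiliser.

Variables (k n : nat).
Hypothesis hk : (1 < k)%N.
Local Notation V := 'rV['Z_k]_n.
Local Notation e i := (delta_mx 0 i : V).
Local Notation Omega := (kcube_Omega k n).

Lemma kcube_AP (f : {perm V}) :
  reflect ({morph f : x y / x + y} /\ forall a, (f a \in Omega) = (a \in Omega))
          (f \in kcube_A k n).
Proof.
rewrite inE inE; apply: (iffP andP).
  case=> /andP[_ /morphicP fD] /eqP fO; split=> [x y|a]; first exact: fD.
  by rewrite -{1}fO (mem_imset _ _ perm_inj).
case=> fD fO; split.
  apply/andP; split; first by apply/subsetP => x _; rewrite inE.
  by apply/morphicP => x y _ _; apply: fD.
rewrite eqEcard (card_imset _ perm_inj) leqnn andbT.
by apply/subsetP => _ /imsetP[a Oa ->]; rewrite fO.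
Qed.

Lemma kcube_A_graph_aut (f : {perm V}) : f \in kcube_A k n -> f \in graph_aut (kcube k n).
Proof.
case/kcube_AP => fD fO; apply/graph_autP => x y; rewrite /= !kcube_adjE.
by have := fD (y - x) x; rewrite subrK => ->; rewrite addrK fO.
Qed.

Definition kcube_stab0 := [set f in graph_aut (kcube k n) | f 0 == 0 :> V].

(** An automorphism fixing 0 is additive by rigidity, and preserves [Omega] because this is the
    neighbourhood of 0. *)
Lemma kcube_stab0E : k <> 4 -> kcube_stab0 = kcube_A k n.
Proof.
move=> k4; apply/setP => f; rewrite inE; apply/andP/idP => [[fA /eqP f0]|fA].
  apply/kcube_AP; split; first exact: (graph_aut_additive hk k4).
  by move=> a; have := graph_aut_Omega 0 a fA; rewrite f0 !subr0.
split; first exact: kcube_A_graph_aut.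
by case/kcube_AP: fA => fD _; apply/eqP/(@addrI _ (f 0)); rewrite -fD !addr0.
Qed.

(** Coordinates are pulled back along [s], so [e j] goes to a multiple of [e (s^-1 j)]; the signs
    [t] are indexed by the target coordinate. *)
Definition signed_perm_fun (s : 'S_n) (t : {ffun 'I_n -> bool}) (v : V) : V :=
  \row_i ((-1) ^+ t i * v 0 (s i)).

Lemma signed_perm_fun_inj s t : injective (signed_perm_fun s t).
Proof.
move=> u v /rowP uv; apply/rowP => i; have := uv (s^-1 i)%g.
by rewrite !mxE permKV; apply: (can_inj (signrMK _)).
Qed.

Definition signed_perm s t := perm (@signed_perm_fun_inj s t).

Lemma signed_permD s t : {morph signed_perm s t : u v / u + v}.
Proof. by move=> u v; rewrite !permE; apply/rowP => i; rewrite !mxE mulrDr. Qed.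

Lemma signed_permZ s t c v : signed_perm s t (c *: v) = c *: signed_perm s t v.
Proof. by rewrite !permE; apply/rowP => i; rewrite !mxE mulrCA. Qed.

Lemma signed_perm_delta s t j :
  signed_perm s t (e j) = (-1) ^+ t (s^-1 j)%g *: e (s^-1 j)%g.
Proof.
rewrite permE; apply/rowP => i; rewrite !mxE !eqxx /= (canF_eq (permK s)).
by have [->//|_] := eqVneq i; rewrite !mulr0.
Qed.

Lemma signed_perm_A s t : signed_perm s t \in kcube_A k n.
Proof.
apply/kcube_AP; split; first exact: signed_permD.
have O s' t' a : a \in Omega -> signed_perm s' t' a \in Omega.
  case/OmegaP => i [b ->]; rewrite signed_permZ signed_perm_delta scalerA -signr_addb.
  by apply/OmegaP; exists (s'^-1 i)%g, (b (+) t' (s'^-1 i)%g).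
move=> a; apply/idP/idP => [|aO]; last exact: (O s t a aO).
(* These parameters describe the inverse of [signed_perm s t]. *)
move/(O s^-1%g [ffun i => t (s^-1 i)%g]).
set b := signed_perm _ _ _; suff -> : b = a by [].
rewrite /b !permE.
by apply/rowP => i; rewrite !mxE ffunE permKV signrMK.
Qed.

Lemma kcube_A_signed_perm (f : {perm V}) :
  f \in kcube_A k n -> exists s t, f = signed_perm s t.
Proof.
case/kcube_AP => fD fO.
have /fin_all_exists[p /fin_all_exists[b fE]] i : exists j (c : bool), f (e i) = (-1) ^+ c *: e j.
  by apply/OmegaP; rewrite fO delta_Omega.
have f0 : f 0 = 0 by apply: (@addrI _ (f 0)); rewrite -fD !addr0.
have fN x : f (- x) = - f x by apply/eqP; rewrite -addr_eq0 -fD addNr f0.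
have fS (c : bool) x : f ((-1) ^+ c *: x) = (-1) ^+ c *: f x.
  by case: c; rewrite ?expr1 ?expr0 ?scaleN1r ?scale1r ?fN.
(* Multiplying [e i] by its own sign [b i] makes the image exactly [e (p i)], so [p i = p j]
   contradicts the injectivity of [f] unless [i = j]. *)
have p_inj : injective p.
  move=> i j pij; have : f ((-1) ^+ b i *: e i) = f ((-1) ^+ b j *: e j).
    by rewrite !fS !fE pij !scalerA -!signr_addb !addbb.
  by move/perm_inj/(signed_delta_inj hk)=> [].
(* The inverses compensate for the pullback convention of [signed_perm_fun]. *)
exists (perm p_inj)^-1%g, [ffun i => b ((perm p_inj)^-1 i)%g].
apply/permP/additive_ext => //; first exact: signed_permD.
by move=> i; rewrite signed_perm_delta invgK ffunE permK permE fE.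
Qed.

Lemma signed_perm_inj2 s s' t t' :
  signed_perm s t = signed_perm s' t' -> s = s' /\ (k <> 2 -> t = t').
Proof.
move=> /permP E.
have {}E j := etrans (esym (signed_perm_delta s t j)) (etrans (E _) (signed_perm_delta s' t' j)).
have ss : s = s'.
  apply: invg_inj; apply/permP => j.
  by case/(signed_delta_inj hk): (E j).
split=> // k2; apply/ffunP => i; case/(signed_delta_inj hk): (E (s i)) => _ /(_ k2).
by rewrite -ss permK.
Qed.

Lemma actperm_coord_perm (s : 'S_n) :
  actperm (coord_perm_action k n) s = signed_perm s^-1 [ffun=> false].
Proof.
apply/permP => v; rewrite actpermE permE; apply/rowP => i.
by rewrite !mxE ffunE mul1r.
Qed.

Lemma actperm_kcube_A (f : {perm V}) : actperm (kcube_A_groupAction k n) f = f.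
Proof. by apply/permP => v; rewrite actpermE. Qed.

Lemma card_kcube_A : k <> 2 -> #|kcube_A k n| = (2 ^ n * n`!)%N.
Proof.
move=> k2.
have -> : kcube_A k n = [set signed_perm u.2 u.1 | u : {ffun 'I_n -> bool} * 'S_n].
  apply/setP => f; apply/idP/imsetP => [/kcube_A_signed_perm[s [t ->]]|[u _ ->]].
    by exists (t, s).
  exact: signed_perm_A.
rewrite card_imset; last first.
  by move=> [t s] [t' s'] /signed_perm_inj2[/= -> ->].
by rewrite card_prod card_ffun card_bool card_ord card_Sn.
Qed.

(** * Translations and the semidirect decomposition *)

Definition translation (v : V) : {perm V} := perm (@addIr _ v).

Lemma translationE v x : translation v x = x + v.
Proof. exact: permE. Qed.

Lemma translationM : {in [set: V] &, {morph translation : u v / (u * v)%g}}.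
Proof.
by move=> u v _ _; apply/permP => x; rewrite permM !translationE addrA.
Qed.

Canonical translation_morphism := Morphism translationM.

Lemma translation_graph_aut v : translation v \in graph_aut (kcube k n).
Proof.
apply/graph_autP => x y; rewrite /= !kcube_adjE !translationE.
by rewrite opprD addrACA subrr addr0.
Qed.

Lemma injm_translation : ('injm translation_morphism)%g.
Proof.
by apply/injmP => u v _ _ /permP/(_ 0); rewrite !translationE !add0r.
Qed.

(** Stated for any group [D] acting faithfully as the stabiliser of 0, so as to serve both ['S_n]
    and [kcube_A k n]. *)
Lemma graph_aut_kcube_isog_sdprod (gT : finGroupType) (D : {group gT})
    (to : groupAction D [set: V]) (rho : {morphism D >-> {perm V}}) :
    {in D, forall a v, rho a v = to v a} ->
    ('injm rho)%g -> (rho @* D)%g = kcube_stab0 ->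
  (graph_aut (kcube k n) \isog [set: sdprod_by to])%g
  /\ #|graph_aut (kcube k n)| = (k ^ n * #|D|)%N.
Proof.
move=> rhoE injrho imrho.
(* Conjugating the translation by [v] with the additive map [rho a] gives the translation by
   [to v a]. *)
have actf : {in [set: V]%G & D, morph_act to 'J%act translation_morphism rho}.
  move=> v a _ Da; apply/permP => x.
  have := actperm_Aut to Da; rewrite inE => /andP[_ /morphicP toD].
  have aD u w : actperm to a (u + w) = actperm to a u + actperm to a w.
    by apply: toD; rewrite inE.
  have rhoD u w : rho a (u + w) = rho a u + rho a w.
    by rewrite !rhoE // -!actpermE aD.
  rewrite /= translationE conjgE !permM translationE -{1}[x](permKV (rho a)).
  by rewrite -rhoE // -rhoD.
have TI : (translation @* [set: V] :&: rho @* D = 1)%g.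
  apply/trivgP/subsetP => _ /setIP[/morphimP[v _ _ ->]].
  rewrite /= imrho inE => /andP[_]; rewrite translationE add0r => /eqP ->.
  by rewrite inE; apply/eqP/permP => x; rewrite translationE addr0 perm1.
have prodE : (translation @* [set: V] * rho @* D = graph_aut (kcube k n))%g.
  apply/eqP; rewrite imrho eqEsubset; apply/andP; split.
    apply/subsetP => _ /mulsgP[_ f /morphimP[v _ _ ->] /setIdP[fA _] ->].
    by apply: (@groupM _ (graph_aut_group (kcube k n))) => //; apply: translation_graph_aut.
  apply/subsetP => f fA.
  (* Translating by [v] and then applying [f] fixes 0; so [f] is the translation by [- v] followed
     by an element of the stabiliser. *)
  pose v := (f^-1)%g (0 : V).
  rewrite -[f](mulKVg (translation (- v))).
  apply: mem_mulg; first by rewrite mem_morphim ?inE.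
  apply/setIdP; split.
    apply: (@groupM _ (graph_aut_group (kcube k n))) => //.
    by rewrite groupV; apply: translation_graph_aut.
  rewrite permM.
  have -> : (translation (- v))^-1%g 0 = v.
    by apply: (@perm_inj _ (translation (- v))); rewrite permKV translationE subrr.
  by rewrite /v permKV.
split; last first.
  rewrite -prodE TI_cardMg // !card_injm ?injm_translation //.
  by rewrite cardsT card_mx card_ord mul1n Zp_cast.
rewrite isog_sym; apply/isogP; exists (xsdprodm actf); last by rewrite im_xsdprodm.
by rewrite injm_xsdprodm injm_translation injrho; apply/eqP.
Qed.

End Stabiliser.

(** * The two isomorphism types, the orders, and arc-transitivity *)

Theorem theorem3p7 (k n : nat) (hk : (1 < k)%N) (hn : (0 < n)%N) :
  [/\ k = 2%N ->
        (graph_aut (kcube k n) \isog [set: sdprod_by (coord_perm_groupAction 2 n)])%g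
        /\ #|graph_aut (kcube k n)| = (2 ^ n * n`!)%N,
      (2 < k)%N -> k <> 4%N ->
        (graph_aut (kcube k n) \isog [set: sdprod_by (kcube_A_groupAction k n)])%g
        /\ #|graph_aut (kcube k n)| = (k ^ n * 2 ^ n * n`!)%N
    & symmetric_graph (kcube k n)].
Proof.
split=> [k2|k2 k4|].
- subst k; rewrite -[in n`!](card_Sn n) -cardsT.
  apply: (graph_aut_kcube_isog_sdprod hk (rho := actperm_morphism (coord_perm_action 2 n))).
  + by move=> s _ v; apply: actpermE.
  + apply/injmP => s t _ _ /=; rewrite !actperm_coord_perm.
    by case/(signed_perm_inj2 hk) => /invg_inj.
  rewrite kcube_stab0E //; apply/setP => f; apply/morphimP/idP.
    by case=> s _ _ ->; rewrite /= actperm_coord_perm; apply: signed_perm_A.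
  case/(kcube_A_signed_perm hk) => s [t ->]; exists s^-1%g; rewrite ?inE //=.
  (* In ['Z_2] the elements 1 and -1 agree, so the signs [t] may be replaced by trivial ones. *)
  rewrite actperm_coord_perm invgK; apply/permP => v; rewrite !permE.
  apply/rowP => i; rewrite !mxE ffunE; congr (_ * _).
  by case: (t i); apply/val_inj.
- have k2' : k <> 2%N by move=> h; rewrite h in k2.
  rewrite -mulnA -(card_kcube_A n hk k2').
  apply: (graph_aut_kcube_isog_sdprod hk (rho := actperm_morphism (kcube_A_groupAction k n))).
  + by move=> f _ v; apply: actpermE.
  + by apply/injmP => f g _ _ /=; rewrite !actperm_kcube_A.
  rewrite kcube_stab0E //; apply/setP => f; apply/morphimP/idP.
    by case=> g _ gA ->; rewrite /= actperm_kcube_A.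
  by move=> fA; exists f => //=; rewrite actperm_kcube_A.
move=> u v x y /=; rewrite !kcube_adjE.
case/OmegaP => i [s uv] /OmegaP[j [t xy]].
(* The transposition carries axis [i] to axis [j], and the constant sign turns [(-1) ^+ s] into
   [(-1) ^+ t]. *)
pose m := signed_perm k (tperm i j) [ffun _ : 'I_n => s (+) t].
have mA : m \in kcube_A k n by apply: signed_perm_A.
have mb : m (v - u) = y - x.
  rewrite uv signed_permZ signed_perm_delta ffunE tpermV tpermL scalerA.
  by rewrite -signr_addb addKb xy.
(* Composed from left to right: [u] goes to 0, 0, [x], and [v] to [v - u], [y - x], [y]. *)
exists (translation (- u) * m * translation x)%g; split.
- have tA := translation_graph_aut (k := k) (n := n).
  by do 2?apply: (@groupM _ (graph_aut_group (kcube k n))) => //; apply: kcube_A_graph_aut.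
- rewrite !permM !translationE subrr -[0 : 'rV_n](scale0r (delta_mx 0 i)).
  by rewrite signed_permZ !scale0r add0r.
by rewrite !permM !translationE mb subrK.
Qed.
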